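(* For every positive integer $d$, $f(d+2)\ge 2f(d)$, where $f(d)$ denotes the maximum size of an acute set in $\mathbb{R}^d$.
   Context: A set $S$ of points in $\mathbb{R}^d$ (with the standard Euclidean inner product $\langle\cdot,\cdot\rangle$) is called acute if any three distinct points of $S$ form only acute angles, i.e. for all pairwise distinct $x,y,z\in S$ the angle at $x$ between $y-x$ and $z-x$ is strictly less than $\pi/2$, equivalently $\langle y-x,z-x\rangle>0$. (Sets with at most two points are vacuously acute.) For a positive integer $d$, $f(d)$ denotes the maximum cardinality of an acute set in $\mathbb{R}^d$; this maximum is known to be finite. *)

(* Defs.v *)
From HB Require Import structures.
From mathcomp Require Import all_boot all_order all_algebra.
From mathcomp Require Import all_classical all_reals all_analysis.
From mathcomp Require Import finmap ring lra.
Set Implicit Arguments. Unset Strict Implicit. Unset Printing Implicit Defensive.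
Import Order.TTheory GRing.Theory Num.Theory.
Local Open Scope classical_set_scope.
Local Open Scope ring_scope.

(* Points of R^d are row vectors over an arbitrary [R : realType]. *)
Definition dotp (R : realType) (d : nat) (u v : 'rV[R]_d) : R :=
  \sum_(i < d) u 0 i * v 0 i.

(* Not the library norm [`|u|], which is the max norm on ['rV[R]_d]. *)
Definition enorm (R : realType) (d : nat) (u : 'rV[R]_d) : R :=
  Num.sqrt (dotp u u).

(* The angle at the vertex [x]; only meaningful for [y] and [z] distinct
   from [x]. *)
Definition angle (R : realType) (d : nat) (x y z : 'rV[R]_d) : R :=
  acos (dotp (y - x) (z - x) / (enorm (y - x) * enorm (z - x))).

(* Quantifying over all orderings of the three points covers the three angles
   of each triple. *)
Definition acute (R : realType) (d : nat) (S : set 'rV[R]_d) : Prop :=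
  forall x y z, S x -> S y -> S z -> x != y -> x != z -> y != z ->
    angle x y z < pi / 2.

Section DotProduct.
Context (R : realType) (d : nat).
Implicit Types u v w x y z : 'rV[R]_d.

Lemma dotpC u v : dotp u v = dotp v u.
Proof. by apply: eq_bigr => i _; rewrite mulrC. Qed.

Lemma dotpDl u v w : dotp (u + v) w = dotp u w + dotp v w.
Proof.
by rewrite /dotp -big_split /=; apply: eq_bigr => i _; rewrite mxE mulrDl.
Qed.

Lemma dotpZl a u w : dotp (a *: u) w = a * dotp u w.
Proof.
by rewrite /dotp mulr_sumr; apply: eq_bigr => i _; rewrite mxE mulrA.
Qed.

Lemma dotpNl u w : dotp (- u) w = - dotp u w.
Proof. by rewrite -scaleN1r dotpZl mulN1r. Qed.

Lemma dotp_ge0 u : 0 <= dotp u u.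
Proof. by apply: sumr_ge0 => i _; rewrite -expr2 sqr_ge0. Qed.

Lemma dotp_gt0 u : u != 0 -> 0 < dotp u u.
Proof.
move=> u0; rewrite lt_neqAle dotp_ge0 andbT eq_sym; apply: contra_neq u0.
move=> /psumr_eq0P u0; apply/rowP => i; rewrite mxE; apply/eqP.
by rewrite -sqrf_eq0 expr2 u0// => j _; rewrite -expr2 sqr_ge0.
Qed.

Lemma enorm_gt0 u : u != 0 -> 0 < enorm u.
Proof. by move=> u0; rewrite sqrtr_gt0 dotp_gt0. Qed.

Lemma cauchy_schwarz u v : v != 0 -> dotp u v ^+ 2 <= dotp u u * dotp v v.
Proof.
move=> /dotp_gt0 v0.
have := dotp_ge0 (dotp v v *: u + (- dotp u v) *: v).
rewrite dotpDl !dotpZl 2!(dotpC _ (_ + _)) !dotpDl !dotpZl (dotpC v u) => h.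
rewrite -subr_ge0 -(pmulr_rge0 _ v0).
by apply: le_trans h _; rewrite le_eqVlt; apply/orP; left; apply/eqP; ring.
Qed.

Lemma angle_lt_pihalf x y z : x != y -> x != z ->
  (angle x y z < pi / 2) = (0 < dotp (y - x) (z - x)).
Proof.
rewrite eq_sym -subr_eq0 => yx; rewrite eq_sym -subr_eq0 => zx.
rewrite /angle; set u := y - x in yx *; set v := z - x in zx *.
have u0 := enorm_gt0 yx; have v0 := enorm_gt0 zx.
have uv0 : 0 < enorm u * enorm v by rewrite mulr_gt0.
set c := dotp u v / _.
have cB : -1 <= c <= 1.
  rewrite -ler_norml -(@ler_pXn2r _ 2) ?nnegrE// expr1n real_normK ?num_real//.
  rewrite expr_div_n ler_pdivrMr ?exprn_gt0// mul1r exprMn.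
  by rewrite !sqr_sqrtr ?dotp_ge0// cauchy_schwarz.
have -> : (0 < dotp u v) = (0 < c) by rewrite pmulr_lgt0 ?invr_gt0.
have aB : acos c \in `[0, pi] by rewrite in_itv/= acos_ge0// acos_lepi.
have hB : pi / 2 \in `[0, pi : R].
  by rewrite in_itv/=; have := pi_gt0 R; lra.
rewrite -(ltr_cos aB hB).
by rewrite cos_pihalf acosK ?in_itv.
Qed.

End DotProduct.

Lemma acuteE (R : realType) (d : nat) (S : set 'rV[R]_d) :
  acute S <->
  forall x y z, S x -> S y -> S z -> x != y -> x != z -> y != z ->
    0 < dotp (y - x) (z - x).
Proof.
by split=> aS x y z Sx Sy Sz xy xz yz; have := aS x y z Sx Sy Sz xy xz yz;
  rewrite angle_lt_pihalf.
Qed.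

Definition acute_card (R : realType) (d : nat) : pred nat :=
  fun n => `[< exists S : set 'rV[R]_d, acute S /\ (S #= `I_n)%card >].

Lemma acute_card_ex (R : realType) (d : nat) : exists n, acute_card R d n.
Proof.
by exists 0%N; apply/asboolP; exists set0; split=> //; rewrite II0.
Qed.

(* Colour each pair [i < j] of indices by the sign pattern of [x j - x i].
   For [j < k], if the same colours occur on the pairs ending at [j] and at [k]
   then some [i < j] gives [x j - x i] and [x k - x j] the same pattern, and the
   angle at [x j] is not acute. *)
Lemma acute_card_le (R : realType) (d : nat) (n : nat) :
  acute_card R d n -> (n <= 2 ^ (2 ^ d))%N.
Proof.
move=> /asboolP[S [/acuteE aS /card_set_bijP[f [_ _ fS]]]].
have /choice[x xP] : forall j : 'I_n, exists u, S u /\ f u = j.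
  by move=> j; have [u Su fu] := fS _ (ltn_ord j); exists u.
have xS j : S (x j) := (xP j).1.
have xI : injective x.
  by move=> i j ij; apply: val_inj; rewrite /= -(xP i).2 -(xP j).2 ij.
pose sg (u : 'rV[R]_d) : {ffun 'I_d -> bool} := [ffun i => 0 <= u 0 i].
pose L (j : 'I_n) := [set sg (x j - x i) | i : 'I_n & (i < j)%N]%SET.
have sgP u v : sg u = sg v -> 0 <= dotp u v.
  move=> /ffunP uv; apply: sumr_ge0 => i _; move: (uv i); rewrite !ffunE.
  case: (leP 0 (u 0 i)) => u0 /esym; first by move=> v0; rewrite mulr_ge0.
  by move=> /negbT; rewrite -ltNge => v0; rewrite nmulr_rge0// ltW.
have xN (i j : 'I_n) : (i < j)%N -> x i != x j.
  by move=> ij; apply: contraTneq ij => /xI ->; rewrite ltnn.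
have LP : forall j k : 'I_n, (j < k)%N -> L j <> L k.
  move=> j k jk Ljk.
  have : sg (x k - x j) \in L k by apply/imsetP; exists j; rewrite ?inE.
  rewrite -Ljk => /imsetP[i]; rewrite inE => ij /sgP.
  have ik := ltn_trans ij jk.
  have : 0 < dotp (x k - x j) (x i - x j).
    by apply: aS; [exact: xS..|exact: xN|rewrite eq_sym xN|rewrite eq_sym xN].
  by rewrite -(opprB (x i) (x j)) [X in _ -> 0 <= X -> _]dotpC dotpNl dotpC
    oppr_ge0 ltNge => /negP.
have /leq_card : injective L.
  move=> j k Ljk; apply: val_inj => /=; case: (ltngtP j k) => // jk.
    by case: (LP _ _ jk Ljk).
  by case: (LP _ _ jk (esym Ljk)).
by rewrite card_ord -cardsT -powersetT card_powerset cardsT card_ffun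
  card_bool card_ord.
Qed.

Lemma acute_finite (R : realType) (d : nat) (S : set 'rV[R]_d) :
  acute S -> finite_set S.
Proof.
move=> aS; apply: contrapT => /(infinite_set_fset (2 ^ (2 ^ d)).+1)[B BS].
apply/negP; rewrite -leqNgt; apply: (@acute_card_le R d); apply/asboolP.
exists [set` B]; split; last exact/card_eq_fsetP.
by move=> x y z /BS Sx /BS Sy /BS Sz; exact: aS.
Qed.

(* The maximum ranges over all acute sets: they are finite by
   [acute_finite], and their cardinals are bounded by [acute_card_le]. *)
Definition max_acute (R : realType) (d : nat) : nat :=
  ex_maxn (acute_card_ex R d) (@acute_card_le R d).

(* Main.v *)
(** Given an acute set x_1, ..., x_n in R^d, take the 2n points
    (x_i, e w_i), (x_i, - e w_i) of R^(d+2), where the w_i are unit vectors of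
    the plane, pairwise distinct up to sign. If two points lie over x_j and x_k
    with j, k <> i, the angle they subtend at a point over x_i is acute for
    small e, by perturbation. The angle at (x_i, e w_i) between its twin
    (x_i, - e w_i) and (x_k, +- e w_k) has scalar product
    2 e^2 (1 -+ <w_i, w_k>), positive for every e <> 0. *)
Require Import Defs.
From mathcomp Require Import all_boot all_order all_algebra.
From mathcomp Require Import all_classical all_reals all_analysis.
From mathcomp Require Import ring lra.
Set Implicit Arguments. Unset Strict Implicit. Unset Printing Implicit Defensive.
Import Order.TTheory GRing.Theory Num.Theory.
Local Open Scope classical_set_scope.
Local Open Scope ring_scope.

(* Taking [j = k] shows that such a family is injective. *)
Definition acute_family (R : realType) (d : nat) (I : finType)
    (x : I -> 'rV[R]_d) : Prop :=
  forall i j k, i != j -> i != k -> 0 < dotp (x j - x i) (x k - x i).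

Section DotProduct.
Context (R : realType).

Lemma dotpDr d (u v w : 'rV[R]_d) : dotp u (v + w) = dotp u v + dotp u w.
Proof. by rewrite !(dotpC u) dotpDl. Qed.

Lemma dotpNr d (u v : 'rV[R]_d) : dotp u (- v) = - dotp u v.
Proof. by rewrite !(dotpC u) dotpNl. Qed.

Lemma dotpZr d a (u v : 'rV[R]_d) : dotp u (a *: v) = a * dotp u v.
Proof. by rewrite !(dotpC u) dotpZl. Qed.

Lemma dotp0l d (u : 'rV[R]_d) : dotp 0 u = 0.
Proof. by rewrite -(scale0r 0) dotpZl mul0r. Qed.

Lemma dotp_row_mx d e (u u' : 'rV[R]_d) (v v' : 'rV[R]_e) :
  dotp (row_mx u v) (row_mx u' v') = dotp u u' + dotp v v'.
Proof.
by rewrite /dotp big_split_ord; congr (_ + _); apply: eq_bigr => i _;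
  rewrite ?row_mxEl ?row_mxEr.
Qed.

End DotProduct.

(** With the converse below, this trades sets for indexed points, so that doubling becomes taking
    the product of the index type with [bool]. *)
Lemma acute_family_card (R : realType) (d : nat) (I : finType)
  (x : I -> 'rV[R]_d) : acute_family x -> acute_card R d #|I|.
Proof.
move=> ax; have xI : injective x.
  move=> i j xij; apply/eqP; apply: contraT => ij.
  by have := ax i j j ij ij; rewrite xij subrr dotp0l ltxx.
apply/asboolP; exists (range x); split.
  apply/acuteE => _ _ _ [i _ <-] [j _ <-] [k _ <-] xij xik _.
  by apply: ax; [apply: contra_neq xij|apply: contra_neq xik] => ->.
rewrite (card_eql (inj_card_eq (in2W xI))).
apply/card_set_bijP; exists (fun i => enum_rank i : nat); split=> //.
- by move=> i _ /=; exact: ltn_ord.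
- by move=> i j _ _ /val_inj/enum_rank_inj.
- by move=> k /= kI; exists (enum_val (Ordinal kI)); rewrite ?enum_valK.
Qed.

Lemma acute_card_family (R : realType) (d n : nat) :
  acute_card R d n -> exists x : 'I_n -> 'rV[R]_d, acute_family x.
Proof.
move=> /asboolP[S [/acuteE aS /card_set_bijP[f [_ _ fS]]]].
have /choice[x xP] : forall j : 'I_n, exists u, S u /\ f u = j.
  by move=> j; have [u Su fu] := fS _ (ltn_ord j); exists u.
have xN i j : i != j -> x i != x j.
  by apply: contra_neq => ij; apply: val_inj; rewrite /= -(xP i).2 -(xP j).2 ij.
exists x => i j k ij ik; have [<-|jk] := eqVneq j k.
  (* [acute] speaks only of three distinct points; for [j = k] the scalar product is a nonzero
     squared length. *)
  by rewrite dotp_gt0// subr_eq0 eq_sym xN.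
by apply: aS; [exact: (xP _).1..|exact: xN|exact: xN|exact: xN].
Qed.

(** Unit vectors of the closed first quadrant have nonnegative scalar products and are never
    opposite, so distinct abscissas [1 / (i + 1)] suffice. *)
Lemma unit_vectors (R : realType) : exists w : nat -> 'rV[R]_2,
  (forall i, dotp (w i) (w i) = 1) /\
  (forall i j, i != j -> `|dotp (w i) (w j)| < 1).
Proof.
pose a i : R := i.+1%:R^-1; pose b i := Num.sqrt (1 - a i ^+ 2).
have a0 i : 0 < a i by rewrite invr_gt0 ltr0n.
have a1 i : a i <= 1 by rewrite invf_le1 ?ltr0n// ler1n.
have b0 i : 0 <= b i by exact: sqrtr_ge0.
have abE i : a i ^+ 2 + b i ^+ 2 = 1.
  rewrite sqr_sqrtr; first by ring.
  by rewrite subr_ge0 expr_le1// ltW.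
pose w i : 'rV[R]_2 := \row_(k < 2) (if k == 0 then a i else b i).
have wE i j : dotp (w i) (w j) = a i * a j + b i * b j.
  by rewrite /dotp !big_ord_recl big_ord0 !mxE addr0.
exists w; split=> [i|i j ij]; rewrite wE; first by rewrite -!expr2.
have aij : 0 < (a i - a j) ^+ 2.
  rewrite exprn_even_gt0//= subr_eq0; apply: contra_neq ij.
  by move=> /invr_inj/eqP; rewrite eqr_nat => /eqP[].
have bij := sqr_ge0 (b i - b j).
have aa : 0 < a i * a j by exact: mulr_gt0.
have bb : 0 <= b i * b j by exact: mulr_ge0.
rewrite ger0_norm; last by rewrite addr_ge0// ltW.
(* The sum of [aij] and [bij] says that the squared distance [2 - 2 <w_i, w_j>] is positive. *)
have := abE i; have := abE j; rewrite !sqrrB in aij bij; lra.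
Qed.

Lemma small_perturbation (R : realType) (I : finType) (P : pred I)
    (D E : I -> R) : (forall i, P i -> 0 < D i) ->
  exists2 e, 0 < e & forall i, P i -> 0 < D i + e ^+ 2 * E i.
Proof.
(* The sum dominates every ratio [|E i| / D i]; the added 1 makes the bound strict and gives
   [M <= M ^+ 2]. *)
move=> D0; pose M := 1 + \sum_(i | P i) `|E i| / D i.
have s0 i : P i -> 0 <= `|E i| / D i by move=> /D0 Di; rewrite divr_ge0// ltW.
have M1 : 1 <= M by rewrite lerDl sumr_ge0.
have M0 : 0 < M by exact: lt_le_trans M1.
exists M^-1; first by rewrite invr_gt0.
move=> i Pi; have EM : `|E i| < M * D i.
  rewrite -ltr_pdivrMr ?D0// /M (bigD1 i)//= addrCA ltrDl.
  rewrite (@lt_le_trans _ _ 1)// lerDl sumr_ge0// => j /andP[Pj _]; exact: s0.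
(* After scaling by [M ^+ 2] the claim follows from [M ^+ 2 * D i >= M * D i > |E i|]. *)
rewrite exprVn -(pmulr_rgt0 _ (exprn_gt0 2 M0)) mulrDr mulrA divff; last first.
  by rewrite expf_neq0// gt_eqF.
have : M * D i <= M ^+ 2 * D i.
  by rewrite ler_pM2r ?D0// expr2 ler_peMl// ltW.
have := ler_norm (- E i); rewrite normrN; lra.
Qed.

Lemma acute_family_double (R : realType) (d n : nat) (x : 'I_n -> 'rV[R]_d) :
  acute_family x ->
  exists y : 'I_n * bool -> 'rV[R]_(d + 2), acute_family y.
Proof.
move=> ax; have [w [w1 wlt1]] := unit_vectors R.
pose v (p : 'I_n * bool) := (-1) ^+ p.2 *: w p.1.
(* There are finitely many triples of signed indices, so one [e] serves all those whose apex index
   differs from the other two. *)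
have [e e0 eP] := @small_perturbation R
  (('I_n * bool) * ('I_n * bool) * ('I_n * bool))%type
  (fun t => (t.1.1.1 != t.1.2.1) && (t.1.1.1 != t.2.1))
  (fun t => dotp (x t.1.2.1 - x t.1.1.1) (x t.2.1 - x t.1.1.1))
  (fun t => dotp (v t.1.2 - v t.1.1) (v t.2 - v t.1.1))
  (fun t H => ax _ _ _ (proj1 (andP H)) (proj2 (andP H))).
exists (fun p => row_mx (x p.1) (e *: v p)) => p q r pq pr.
have v1 p' : dotp (v p') (v p') = 1.
  by rewrite dotpZl dotpZr mulrA -expr2 sqrr_sign mul1r w1.
have vlt1 p' q' : p'.1 != q'.1 -> `|dotp (v p') (v q')| < 1.
  by move=> pq'; rewrite dotpZl dotpZr !normrM !normr_sign !mul1r wlt1.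
have twin p' q' : p' != q' -> p'.1 = q'.1 -> v q' = - v p'.
  case: p' q' => [i s] [j t] /= + ij; rewrite -{j}ij xpair_eqE eqxx /= => st.
  rewrite /v /= -scaleNr; congr (_ *: _).
  by case: s t st => [] [] //= _; rewrite !(expr0, expr1) ?opprK.
(* Since [v q' = - v p'], the value is [2 - 2 <v p', v r'>]; it equals 4 when [r'] is also the twin
   of [p']. *)
have twin_gt0 p' q' r' : p' != q' -> p' != r' -> p'.1 = q'.1 ->
    0 < dotp (v q' - v p') (v r' - v p').
  move=> pq' pr' ipq; rewrite (twin _ _ pq' ipq).
  have [ipr|ipr] := eqVneq p'.1 r'.1.
    rewrite (twin _ _ pr' ipr) !(dotpDl, dotpDr, dotpNl, dotpNr) v1; lra.
  rewrite !(dotpDl, dotpDr, dotpNl, dotpNr) v1.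
  have := ler_norm (dotp (v p') (v r')); have := vlt1 _ _ ipr; lra.
rewrite !opp_row_mx !add_row_mx dotp_row_mx -!scalerBr dotpZl dotpZr mulrA.
rewrite -expr2; have e20 : 0 < e ^+ 2 by exact: exprn_gt0.
have [ipq|ipq] := eqVneq p.1 q.1.
  rewrite ipq subrr dotp0l add0r.
  by rewrite mulr_gt0// twin_gt0.
have [ipr|ipr] := eqVneq p.1 r.1.
  rewrite ipr subrr dotpC dotp0l add0r.
  by rewrite mulr_gt0// dotpC twin_gt0.
by apply: (eP (p, q, r)); rewrite /= ipq ipr.
Qed.

Theorem theorem1 (R : realType) (d : nat) (hd : (0 < d)%N) :
  (2 * max_acute R d <= max_acute R (d + 2))%N.
Proof.
rewrite /max_acute; case: ex_maxnP => n /acute_card_family[x ax] _.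
case: ex_maxnP => m _; apply.
have [y /acute_family_card] := acute_family_double ax.
by rewrite card_prod card_ord card_bool mulnC.
Qed.
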